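(* Let $F$ be a field of characteristic $p\neq 3$. Let $L_1/F$ and $L_2/F$ be two extensions of degree $3$, and for $i=1,2$ let $y_i$ be a generator of $L_i/F$ with $y_i^3-3y_i=a_i$, $a_i\in F$, such that the polynomial $X^2+a_iX+1$ is irreducible over $F$. Then the following are equivalent: (1) $L_1\simeq L_2$ as extensions of $F$; (2) there exist $\alpha,\beta\in F$ with $\alpha^2+a_2\alpha\beta+\beta^2=1$ such that, under an $F$-isomorphism identifying $L_1$ with $L_2$, $y_1=\alpha y_2^2+\beta y_2-2\alpha$; (3) there exist $\alpha,\beta\in F$ with $\alpha^2+a_2\alpha\beta+\beta^2=1$ such that $a_1=-3a_2\alpha^2\beta+a_2\beta^3+6\alpha+\alpha^3a_2^2-8\alpha^3$. *)

(* Defs.v *)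
From HB Require Import structures.
From mathcomp Require Import all_boot all_order all_algebra all_field.

Set Implicit Arguments.
Unset Strict Implicit.
Unset Printing Implicit Defensive.

(* Main.v *)
(** Since [L1] is generated by a root of the cubic [X^3 - 3 X - a1], an
    [F]-morphism from [L1] to [L2] is the same thing as a root [z] of that cubic
    in [L2], and by dimension it is an isomorphism.  Write [z] as
    [alpha y2^2 + beta y2 + gamma]; as [1, z, z^2] are free, the characteristic
    polynomial of the multiplication by [z] must be [X^3 - 3 X - a1].
    Its trace [3 gamma + 6 alpha] vanishes exactly when [gamma = - 2 alpha]
    (the characteristic is not 3), its linear coefficient is then
    [- 3 (alpha^2 + a2 alpha beta + beta^2)], and its constant coefficient
    gives the formula for [a1]. *)

Require Import Defs.
From HB Require Import structures.
From mathcomp Require Import all_boot all_order all_algebra all_field.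
From mathcomp Require Import ring.

Set Implicit Arguments.
Unset Strict Implicit.
Unset Printing Implicit Defensive.

Import GRing.Theory.
Local Open Scope ring_scope.

Section Generator.

Variables (F : fieldType) (L : fieldExtType F) (y : L).
Hypothesis gen_y : <<1; y>>%VS = {:L}%VS.

Lemma horner_alg_gen_surj v :
  exists2 p : {poly F}, (size p <= \dim {:L})%N & horner_alg y p = v.
Proof.
have /polyOver1P[p def_p] := Fadjoin_polyOver 1%AS y v.
exists p; last first.
  rewrite [LHS]/(map_poly _ p).[y] -def_p.
  by apply: Fadjoin_poly_eq; rewrite gen_y memvf.
rewrite -(size_map_poly (in_alg L)) -def_p.
by rewrite -gen_y dim_Fadjoin dimv1 muln1 size_Fadjoin_poly.
Qed.

(** The minimal polynomial of the generator [y] has degree [\dim {:L}], so no nonzero polynomial of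
    smaller degree vanishes at [y]. *)
Lemma horner_alg_gen_eq0 (p : {poly F}) :
  (size p <= \dim {:L})%N -> horner_alg y p = 0 -> p = 0.
Proof.
move=> szp py0; apply/eqP; rewrite -(map_poly_eq0 (in_alg L)).
rewrite -(@root_small_adjoin_poly _ _ 1%AS y); first exact/rootP.
  by apply/polyOver1P; exists p.
by move: szp; rewrite size_map_poly -gen_y dim_Fadjoin dimv1 muln1.
Qed.

End Generator.

(** By its degree, [q] generates the kernel of evaluation at [y]; evaluation at [z] also kills [q],
    so it factors through [L1], seen as [F[X]/(q)]. *)
Lemma lrmorphism_of_gen (F : fieldType) (L1 L2 : fieldExtType F)
    (y : L1) (z : L2) (q : {poly F}) :
  <<1; y>>%VS = {:L1}%VS -> size q = (\dim {:L1}).+1 ->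
  horner_alg y q = 0 -> horner_alg z q = 0 ->
  exists f : {lrmorphism L1 -> L2}, f y = z.
Proof.
move=> gen_y szq qy qz.
have kerP p : horner_alg y p = 0 -> horner_alg z p = 0.
  have q0 : q != 0 by rewrite -size_poly_gt0 szq.
  rewrite (divp_eq p q) !rmorphD !rmorphM /= qy qz !mulr0 !add0r => py.
  rewrite (horner_alg_gen_eq0 gen_y _ py) ?rmorph0 //.
  by rewrite -ltnS -szq ltn_modp.
have surj v : exists p : {poly F}, horner_alg y p == v.
  by have [p _ <-] := horner_alg_gen_surj gen_y v; exists p.
(* An arbitrary polynomial representing [v] is chosen; by [kerP] the value at [z] does not depend on
   it, which is what [fE] records. *)
pose f v := horner_alg z (xchoose (surj v)).
have fE p : f (horner_alg y p) = horner_alg z p.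
  apply/eqP; rewrite -subr_eq0 -rmorphB; apply/eqP/kerP.
  by rewrite rmorphB /= (eqP (xchooseP (surj _))) subrr.
have ex v : exists p : {poly F}, v = horner_alg y p.
  by have [p _ <-] := horner_alg_gen_surj gen_y v; exists p.
have fL : linear f.
  move=> c u v; have [[p ->] [r ->]] := (ex u, ex v).
  rewrite -mulr_algl -(horner_algC y c) -rmorphM -rmorphD !fE.
  by rewrite rmorphD rmorphM /= horner_algC mulr_algl.
have fM : monoid_morphism f.
  split=> [|u v]; first by rewrite -(rmorph1 (horner_alg y)) fE rmorph1.
  have [[p ->] [r ->]] := (ex u, ex v).
  by rewrite -rmorphM !fE rmorphM.
pose fLM := GRing.isLinear.Build _ _ _ _ _ fL.
pose fMM := GRing.isMonoidMorphism.Build _ _ _ fM.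
pose g : {lrmorphism L1 -> L2} := HB.pack f fLM fMM.
by exists g; rewrite -[y](horner_algX y) [LHS]fE horner_algX.
Qed.

Lemma lrmorphism_bij (F : fieldType) (L1 L2 : fieldExtType F)
    (f : {lrmorphism L1 -> L2}) :
  \dim {:L1} = \dim {:L2} -> bijective f.
Proof.
move=> eqdim; have kerf : lker (linfun f) == 0%VS.
  by apply/lker0P=> u v; rewrite !lfunE /=; apply: fmorph_inj.
have imf : limg (linfun f) = fullv.
  by apply/eqP; rewrite eqEdim subvf limg_dim_eq ?(eqP kerf) ?capv0 //= eqdim.
exists (linfun f)^-1%VF => [u | v].
  by have := lker0_lfunK kerf u; rewrite lfunE.
by have := @limg_lfunVK _ _ _ (linfun f) v; rewrite imf memvf lfunE; apply.
Qed.

Lemma cubic_gen_free (F : fieldType) (L : fieldExtType F) (y : L) (a b c : F) :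
  <<1; y>>%VS = {:L}%VS -> \dim {:L} = 3%N ->
  in_alg L a * y ^+ 2 + in_alg L b * y + in_alg L c = 0 -> [/\ a = 0, b = 0 & c = 0].
Proof.
move=> gen_y dimL eq0; pose p := Poly [:: c; b; a].
have p0 : p = 0.
  apply: (horner_alg_gen_eq0 gen_y); first by rewrite dimL size_Poly.
  rewrite -[RHS]eq0 /p /= !cons_poly_def !(rmorphD, rmorphM) /= !horner_algC.
  rewrite !horner_algX scale0r; ring.
by split; [have := coef_Poly [:: c; b; a] 2 | have := coef_Poly [:: c; b; a] 1
  | have := coef_Poly [:: c; b; a] 0]; rewrite -/p p0 coef0.
Qed.

Lemma cubic_gen_span (F : fieldType) (L : fieldExtType F) (y v : L) :
  <<1; y>>%VS = {:L}%VS -> \dim {:L} = 3%N ->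
  exists a b c : F, v = in_alg L a * y ^+ 2 + in_alg L b * y + in_alg L c.
Proof.
move=> gen_y dimL; have [p szp <-] := horner_alg_gen_surj gen_y v.
exists p`_2, p`_1, p`_0.
rewrite [LHS](@horner_coef_wide _ 3) ?size_map_poly -?dimL // dimL.
rewrite 2!big_ord_recr big_ord1 !coef_map /= mulr1.
by rewrite addrC addrA [LHS]addrAC.
Qed.

Section CubicIdentities.

Variables (R S : comNzRingType) (i : {rmorphism R -> S}).
Variables (a alpha beta : R) (y : S).
Hypothesis eqy : y ^+ 3 - 3%:R * y = i a.

(* The coefficients are those of the characteristic polynomial of the
   multiplication by z on R[y], in the basis 1, y, y ^+ 2. *)
Lemma cubic_charpoly_root gamma :
  let z := i alpha * y ^+ 2 + i beta * y + i gamma in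
  let m := gamma + 3%:R * alpha in
  let k := 3%:R * beta + a * alpha in
  let t := 3%:R * gamma + 6%:R * alpha in
  let s := 2%:R * (gamma * m - a * alpha * beta) + m ^+ 2 - beta * k in
  let n := gamma * (m ^+ 2 - beta * k) - beta * (a * alpha * m - a * beta ^+ 2)
           + alpha * (a * alpha * k - a * beta * m) in
  z ^+ 3 - i t * z ^+ 2 + i s * z - i n = 0.
Proof.
rewrite /= !(rmorphB, rmorphD, rmorphXn, rmorphM, rmorph_nat) -eqy; ring.
Qed.

(** This is the trace-zero case [gamma = - 2 alpha], with the quadratic form equal to 1. It yields
    the formula for [a1] and, conversely, a root in [L2] of the cubic of [y1]. *)
Lemma cubic_root_of_qform1 :
  alpha ^+ 2 + a * alpha * beta + beta ^+ 2 = 1 ->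
  let z := i alpha * y ^+ 2 + i beta * y - i (2%:R * alpha) in
  z ^+ 3 - 3%:R * z =
    i (- (3%:R * a * alpha ^+ 2 * beta) + a * beta ^+ 3
       + 6%:R * alpha + alpha ^+ 3 * a ^+ 2 - 8%:R * alpha ^+ 3).
Proof.
set q := (X in X = 1) => q1 z.
(* Homogenized in (alpha, beta), so that it holds for every value of q. *)
have: z ^+ 3 - i (3%:R * q) * z =
    i (- (3%:R * a * alpha ^+ 2 * beta) + a * beta ^+ 3
       + 6%:R * alpha * q + alpha ^+ 3 * a ^+ 2 - 8%:R * alpha ^+ 3).
  rewrite /z /q !(rmorphB, rmorphD, rmorphN, rmorphXn, rmorphM, rmorph_nat).
  rewrite -eqy; ring.
by rewrite q1 !mulr1 rmorph_nat.
Qed.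

End CubicIdentities.

Theorem mainTheorem3 (F : fieldType) (charF : 3%N \notin [pchar F])
    (L1 L2 : fieldExtType F)
    (dimL1 : \dim {:L1} = 3%N) (dimL2 : \dim {:L2} = 3%N)
    (a1 a2 : F) (y1 : L1) (y2 : L2)
    (geny1 : <<1; y1>>%VS = {:L1}%VS) (geny2 : <<1; y2>>%VS = {:L2}%VS)
    (eqy1 : y1 ^+ 3 - 3%:R * y1 = a1%:A) (eqy2 : y2 ^+ 3 - 3%:R * y2 = a2%:A)
    (irr1 : irreducible_poly ('X^2 + a1 *: 'X + 1))
    (irr2 : irreducible_poly ('X^2 + a2 *: 'X + 1)) :
  [<-> exists f : {lrmorphism L1 -> L2}, bijective f;
       exists alpha beta : F,
         alpha ^+ 2 + a2 * alpha * beta + beta ^+ 2 = 1 /\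
         exists f : {lrmorphism L1 -> L2},
           bijective f /\
           f y1 = alpha *: y2 ^+ 2 + beta *: y2 - (2%:R * alpha)%:A;
       exists alpha beta : F,
         alpha ^+ 2 + a2 * alpha * beta + beta ^+ 2 = 1 /\
         a1 = - (3%:R * a2 * alpha ^+ 2 * beta) + a2 * beta ^+ 3
              + 6%:R * alpha + alpha ^+ 3 * a2 ^+ 2 - 8%:R * alpha ^+ 3].
Proof.
have n3 : 3%:R != 0 :> F.
  by apply: contra charF => /eqP c3; rewrite inE /= c3 eqxx.
tfae.
- case=> f bij_f.
  have [al [be [ga def_z]]] := cubic_gen_span (f y1) geny2 dimL2.
  have eqz : f y1 ^+ 3 = 3%:R * f y1 + in_alg L2 a1.
    have := congr1 f eqy1; rewrite rmorphB rmorphXn rmorphM rmorph_nat.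
    by rewrite linearZ /= rmorph1 => /eqP; rewrite subr_eq addrC => /eqP.
  pose m := ga + 3%:R * al.
  pose k := 3%:R * be + a2 * al.
  pose t := 3%:R * ga + 6%:R * al.
  pose s := 2%:R * (ga * m - a2 * al * be) + m ^+ 2 - be * k.
  pose n := ga * (m ^+ 2 - be * k) - be * (a2 * al * m - a2 * be ^+ 2)
            + al * (a2 * al * k - a2 * be * m).
  have charz : f y1 ^+ 3 - in_alg L2 t * f y1 ^+ 2 + in_alg L2 s * f y1
               - in_alg L2 n = 0.
    by rewrite def_z; exact: (cubic_charpoly_root (i := in_alg L2) _ _ eqy2).
  have fE c2 c1 c0 : f (in_alg L1 c2 * y1 ^+ 2 + in_alg L1 c1 * y1 + in_alg L1 c0)
      = in_alg L2 c2 * f y1 ^+ 2 + in_alg L2 c1 * f y1 + in_alg L2 c0.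
    rewrite /= !mulr_algl 2!(linearD f) 3!(linearZZ f) rmorph1.
    by rewrite (rmorphXn f).
  (* Substituting [z^3 = 3 z + a1] in [charz] leaves a quadratic relation on [z = f y1]. It is
     pulled back along the injective [f] to [L1], where [1, y1, y1^2] are free. *)
  have [t0 s0 _] : [/\ - t = 0, s + 3%:R = 0 & a1 - n = 0].
    apply: (cubic_gen_free geny1 dimL1); apply: (fmorph_inj f).
    rewrite rmorph0; apply: etrans (fE _ _ _) _; rewrite -[RHS]charz eqz.
    move: (in_alg L2 : {rmorphism F -> L2}) => i.
    rewrite !(rmorphN, rmorphD, rmorph_nat); ring.
  have ga_def : ga = - (2%:R * al).
    by apply: (mulfI n3); rewrite -[LHS]addr0 -[X in _ + X]t0 /t; ring.
  (* Once [ga = - 2 al], the sum [s + 3] is 3 times 1 minus the quadratic form, and 3 can be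
     cancelled. *)
  exists al, be; split.
    apply: (mulfI n3); apply/eqP; rewrite mulr1 -subr_eq0 -oppr_eq0; apply/eqP.
    by rewrite -[RHS]s0 /s /k /m ga_def; ring.
  by exists f; split=> //; rewrite def_z ga_def rmorphN /= !mulr_algl.
- case=> al [be [q1 [f [_ def_z]]]]; exists al, be; split=> //.
  (* Both sides are values of [z^3 - 3 z] at [z = f y1]: one by applying [f] to [eqy1], the other by
     the identity in [y2]. *)
  apply: (fmorph_inj (in_alg L2)).
  rewrite -(cubic_root_of_qform1 (i := in_alg L2) eqy2 q1) /= !mulr_algl -def_z.
  rewrite -rmorphXn -(rmorph_nat f) -rmorphM -rmorphB eqy1.
  exact: (esym (rmorph_alg f _)).
- case=> al [be [q1 def_a1]].
  have := cubic_root_of_qform1 (i := in_alg L2) eqy2 q1; rewrite -def_a1.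
  (* [q] is [X^3 - 3 X - a1], constant term first; both [y1] and [z] are roots of it. *)
  set z := _ - _ => eqz; pose q : {poly F} := Poly [:: - a1; - 3%:R; 0; 1].
  have qE (L : fieldExtType F) (x : L) :
      x ^+ 3 - 3%:R * x = in_alg L a1 -> horner_alg x q = 0.
    move=> eqx; rewrite /q /= !cons_poly_def.
    rewrite !(rmorphD, rmorphM) /= !horner_algC !horner_algX.
    rewrite scale0r scale1r !scaleNr -[a1%:A]eqx scaler_nat; ring.
  have szq : size q = (\dim {:L1}).+1.
    by rewrite dimL1 (@PolyK _ 0) //= oner_eq0.
  have [f _] := lrmorphism_of_gen geny1 szq (qE _ _ eqy1) (qE _ _ eqz).
  by exists f; apply: lrmorphism_bij; rewrite dimL1.
Qed.
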